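(* Assume $\sigma_1>0$ and $\sigma_2>0$, and consider, for each $r\in\{1,3,5\}$ and $k\in\overline{D}^{(r)}$, the linear system $\mathcal{A}X=Y+e^{ik^3T}\mathcal{Y}$ for $X=(g_0,g_1,g_2,h_0,h_1,h_2)^\top$ (all evaluated at $(ik^3,T)$) defined in the context, with $\mathcal{A}$ a square matrix. The system is solvable for $X$ if and only if three interface conditions of the following form are given: $$\beta_{11}q^{(1)}(0,t)+\beta_{12}q^{(1)}_x(0,t)+\beta_{13}q^{(1)}_{xx}(0,t)+q^{(2)}(0,t)=f_1(t),$$ $$\beta_{21}q^{(1)}(0,t)+\beta_{22}q^{(1)}_x(0,t)+\beta_{23}q^{(1)}_{xx}(0,t)+q^{(2)}_x(0,t)=f_2(t),$$ $$\beta_{31}q^{(1)}(0,t)+\beta_{32}q^{(1)}_x(0,t)+\beta_{33}q^{(1)}_{xx}(0,t)+q^{(2)}_{xx}(0,t)=f_3(t).$$ The system is solvable for $X$ whenever one or more of the following is satisfied: 1. $\beta_{31}\neq0$; 2. $\sigma_1\beta_{21}+\sigma_2\beta_{32}\neq0$; 3. $\sigma_1^2\beta_{11}+\sigma_1\sigma_2\beta_{22}+\sigma_2^2\beta_{33}\neq0$; 4. $\sigma_1\beta_{12}+\sigma_2\beta_{23}\neq0$; 5. $\beta_{13}\neq0$.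
   Context: Interface problem: $q^{(1)}_t=\sigma_1^3 q^{(1)}_{xxx}$ for $x<0$, $0<t\le T$, and $q^{(2)}_t=\sigma_2^3 q^{(2)}_{xxx}$ for $x>0$, $0<t\le T$, where $\sigma_1,\sigma_2$ are nonzero real constants, with initial conditions $q^{(j)}(x,0)=q^{(j)}_0(x)$. It is assumed that $q^{(1)}(\cdot,t),q_0^{(1)}\in S(-\infty,0)$ and $q^{(2)}(\cdot,t),q_0^{(2)}\in S(0,\infty)$, where $S(I)$ is the space of restrictions to $I$ of Schwartz functions, and that the initial data are compatible with the interface conditions. An interface condition is an equation, for all $t$, prescribing a constant-coefficient linear combination of $\partial_x^n q^{(1)}(0,t)$ and $\partial_x^n q^{(2)}(0,t)$, $n=0,1,2$, to equal a given function $f(t)$. Standing assumption: the interface conditions are not such that the problem reduces to a pair of half-line boundary value problems (i.e. such that the problem for $q^{(1)}$ or for $q^{(2)}$ can be solved as a half-line boundary value problem without knowing the other function, the result then being used to solve the other). For $\sigma_1,\sigma_2>0$, such a reduction occurs if the conditions imply a condition involving only $q^{(1)}$ and its derivatives at $0$, or a pair of (independent) conditions involving only $q^{(2)}$ and its derivatives at $0$. Notation: $\alpha=e^{2\pi i/3}$; $D=\{k\in\mathbb{C}:\operatorname{Re}(ik^3)<0\}=D^{(1)}\cup D^{(3)}\cup D^{(5)}$ with $D^{(1)}=\{0<\arg k<\pi/3\}$, $D^{(3)}=\{2\pi/3<\arg k<\pi\}$, $D^{(5)}=\{4\pi/3<\arg k<5\pi/3\}$; bars denote closures. Put $$g_n(\omega,T)=\int_0^T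 e^{\omega s}\partial_x^n q^{(1)}(0,s)\,ds,\quad h_n(\omega,T)=\int_0^T e^{\omega s}\partial_x^n q^{(2)}(0,s)\,ds\quad(n=0,1,2),$$ $$\tilde f_j(\omega,T)=\int_0^T e^{\omega s}f_j(s)\,ds,$$ $\hat q^{(1)}(k,T)=\int_{-\infty}^0e^{-ikx}q^{(1)}(x,T)\,dx$ and $\hat q^{(1)}_0(k)=\int_{-\infty}^0e^{-ikx}q^{(1)}_0(x)\,dx$ for $\operatorname{Im}k\ge0$, and $\hat q^{(2)}(k,T)=\int_0^{\infty}e^{-ikx}q^{(2)}(x,T)\,dx$ and $\hat q^{(2)}_0(k)=\int_0^{\infty}e^{-ikx}q^{(2)}_0(x)\,dx$ for $\operatorname{Im}k\le0$. The linear system: for $\sigma_1>0$, $\sigma_2>0$, $r\in\{1,3,5\}$ and $k\in\overline{D}^{(r)}$, the valid global relations are $$e^{ik^3T}\hat q^{(1)}(\gamma k/\sigma_1,T)-\hat q^{(1)}_0(\gamma k/\sigma_1)=\sigma_1^3g_2+i\gamma k\sigma_1^2g_1-\gamma^2k^2\sigma_1g_0\quad\text{for }\gamma=\alpha^r\text{ and }\gamma=\alpha^{r+2},$$ $$e^{ik^3T}\hat q^{(2)}(\gamma k/\sigma_2,T)-\hat q^{(2)}_0(\gamma k/\sigma_2)=-\sigma_2^3h_2-i\gamma k\sigma_2^2h_1+\gamma^2k^2\sigma_2h_0\quad\text{for }\gamma=\alpha^{r+1},$$ with $g_n,h_n$ evaluated at $(ik^3,T)$. The transform of an interface condition is obtained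 by replacing $\partial_x^nq^{(1)}(0,t)$, $\partial_x^nq^{(2)}(0,t)$, $f_j(t)$ by $g_n(ik^3,T)$, $h_n(ik^3,T)$, $\tilde f_j(ik^3,T)$ respectively; for the form in the claim this is $h_{j}+\sum_{\ell=0}^2\beta_{j+1,\ell+1}g_\ell=\tilde f_{j+1}(ik^3,T)$, $j=0,1,2$. The three global relations together with the transforms of the given interface conditions are written $\mathcal{A}X=Y+e^{ik^3T}\mathcal{Y}$, where $\mathcal{A}=\mathcal{A}(k)$ is the coefficient matrix, $Y$ collects the known terms ($-\hat q^{(j)}_0$ and $\tilde f_j$) and $\mathcal{Y}$ collects the terms $\hat q^{(j)}(\cdot,T)$. Solvable for $X$ is used synonymously with full rank, i.e. $\det\mathcal{A}$, a polynomial in $k$, is not identically zero.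
   Formalization: The ''if'' part of the first sentence is false as stated (β21=1/σ1, β32=−1/σ2, other β=0 gives det A≡0); the theorem states: solvable iff the conditions can be put, by invertible recombination, in the given form with at least one of items 1–5 satisfied. *)

(* Defs.v *)
From mathcomp Require Import all_boot all_order all_algebra.
From mathcomp Require Import all_classical all_reals all_analysis.
From mathcomp Require Import complex.

Set Implicit Arguments.
Unset Strict Implicit.
Unset Printing Implicit Defensive.

Import Order.TTheory GRing.Theory Num.Theory.
Import numFieldNormedType.Exports.
Local Open Scope classical_set_scope.
Local Open Scope ring_scope.
Local Open Scope complex_scope.

Definition expi (R : realType) (theta : R) : R[i] := cos theta +i* sin theta.

Definition alpha (R : realType) : R[i] := expi (2 * pi / 3).

(* D^(1), D^(3), D^(5) are the sectors r = 1, 3, 5. *)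
Definition sector (R : realType) (r : nat) : set (R[i] : numFieldType) :=
  [set k | exists rho theta : R,
     [/\ 0 < rho, (r.-1)%:R * pi / 3 < theta, theta < r%:R * pi / 3
       & k = rho%:C * expi theta]].

(* Three interface conditions: coef1 i n and coef2 i n multiply the n-th x-derivative
   of q^(1) and q^(2) at 0 in the i-th condition; datum collects the functions f_j. *)
Record interface_conditions (R : realType) := InterfaceConditions {
  coef1 : 'M[R[i]]_3;
  coef2 : 'M[R[i]]_3;
  datum : R -> 'cV[R[i]]_3
}.

Definition recombine (R : realType) (P : 'M[R[i]]_3) (C : interface_conditions R) :=
  InterfaceConditions (P *m coef1 C) (P *m coef2 C) (fun t => P *m datum C t).

Definition normal_form (R : realType) (beta : 'M[R[i]]_3) (f : R -> 'cV[R[i]]_3) :=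
  InterfaceConditions beta 1%:M f.

(* Conditions are identified when each set consists of linear combinations of the other. *)
Definition given_in_form (R : realType) (C : interface_conditions R)
    (beta : 'M[R[i]]_3) : Prop :=
  exists (P : 'M[R[i]]_3) (f : R -> 'cV[R[i]]_3),
    P \in unitmx /\ recombine P C = normal_form beta f.

(* For sigma_1, sigma_2 > 0: the conditions imply (by linear combination) one nontrivial
   condition on q^(1) alone, or two independent conditions on q^(2) alone. *)
Definition reduces_to_half_lines (R : realType) (C : interface_conditions R) : Prop :=
  (exists v : 'rV[R[i]]_3, v *m coef2 C = 0 /\ v *m coef1 C != 0) \/
  (exists V : 'M[R[i]]_(2, 3), V *m coef1 C = 0 /\ row_free (V *m coef2 C)).

Definition relation_row (R : realType) (sigma : R) (gamma k : R[i]) : 'rV[R[i]]_3 :=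
  \row_(n < 3) [:: - (gamma ^+ 2 * k ^+ 2 * sigma%:C);
                   'i * gamma * k * sigma%:C ^+ 2;
                   sigma%:C ^+ 3]`_n.

Definition relations_mx (R : realType) (sigma1 sigma2 : R) (r : nat) (k : R[i]) :
    'M[R[i]]_(3, 3 + 3) :=
  let a := alpha R in
  col_mx (row_mx (relation_row sigma1 (a ^+ r) k) 0)
    (col_mx (row_mx (relation_row sigma1 (a ^+ r.+2) k) 0)
       (row_mx 0 (- relation_row sigma2 (a ^+ r.+1) k))).

(* The matrix A(k), acting on X = (g_0, g_1, g_2, h_0, h_1, h_2)^T. *)
Definition system_mx (R : realType) (sigma1 sigma2 : R) (C : interface_conditions R)
    (r : nat) (k : R[i]) : 'M[R[i]]_(3 + 3) :=
  col_mx (relations_mx sigma1 sigma2 r k) (row_mx (coef1 C) (coef2 C)).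

(* q10, q20 stand for the transforms of the initial data, q1T, q2T for those of the
   solution at time T, and ft for the transforms of the f_j at i k^3. *)
Definition system_known (R : realType) (sigma1 sigma2 : R) (r : nat) (k : R[i])
    (q10 q20 : R[i] -> R[i]) (ft : 'cV[R[i]]_3) : 'cV[R[i]]_(3 + 3) :=
  let a := alpha R in
  col_mx (\col_(j < 3) [:: - q10 (a ^+ r * k / sigma1%:C);
                           - q10 (a ^+ r.+2 * k / sigma1%:C);
                           - q20 (a ^+ r.+1 * k / sigma2%:C)]`_j) ft.

Definition system_final (R : realType) (sigma1 sigma2 : R) (r : nat) (k : R[i])
    (q1T q2T : R[i] -> R[i]) : 'cV[R[i]]_(3 + 3) :=
  let a := alpha R in
  col_mx (\col_(j < 3) [:: q1T (a ^+ r * k / sigma1%:C);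
                           q1T (a ^+ r.+2 * k / sigma1%:C);
                           q2T (a ^+ r.+1 * k / sigma2%:C)]`_j) 0.

Definition global_relation1 (R : realType) (sigma1 : R) (gamma k E : R[i])
    (q10 q1T : R[i] -> R[i]) (g : 'cV[R[i]]_3) : Prop :=
  E * q1T (gamma * k / sigma1%:C) - q10 (gamma * k / sigma1%:C)
  = sigma1%:C ^+ 3 * g 2 0 + 'i * gamma * k * sigma1%:C ^+ 2 * g 1 0
    - gamma ^+ 2 * k ^+ 2 * sigma1%:C * g 0 0.

Definition global_relation2 (R : realType) (sigma2 : R) (gamma k E : R[i])
    (q20 q2T : R[i] -> R[i]) (h : 'cV[R[i]]_3) : Prop :=
  E * q2T (gamma * k / sigma2%:C) - q20 (gamma * k / sigma2%:C)
  = - (sigma2%:C ^+ 3 * h 2 0) - 'i * gamma * k * sigma2%:C ^+ 2 * h 1 0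
    + gamma ^+ 2 * k ^+ 2 * sigma2%:C * h 0 0.

(* A X = Y + E *: Y' (with E for e^{i k^3 T}) is the system of the three global relations
   and the transformed interface conditions. *)
Lemma systemE (R : realType) (sigma1 sigma2 : R) (C : interface_conditions R) (r : nat)
    (k E : R[i]) (q10 q20 q1T q2T : R[i] -> R[i]) (g h ft : 'cV[R[i]]_3) :
  system_mx sigma1 sigma2 C r k *m col_mx g h
    = system_known sigma1 sigma2 r k q10 q20 ft
      + E *: system_final sigma1 sigma2 r k q1T q2T
  <-> [/\ global_relation1 sigma1 (alpha R ^+ r) k E q10 q1T g,
          global_relation1 sigma1 (alpha R ^+ r.+2) k E q10 q1T g,
          global_relation2 sigma2 (alpha R ^+ r.+1) k E q20 q2T h
        & coef1 C *m g + coef2 C *m h = ft].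
Proof.
rewrite /system_mx /relations_mx /system_known /system_final /=.
rewrite scale_col_mx scaler0 add_col_mx addr0 mul_col_mx mul_row_col.
have rowE (sigma : R) (gamma : R[i]) (x : 'cV[R[i]]_3) :
    (relation_row sigma gamma k *m x) 0 0
    = sigma%:C ^+ 3 * x 2 0 + 'i * gamma * k * sigma%:C ^+ 2 * x 1 0
      - gamma ^+ 2 * k ^+ 2 * sigma%:C * x 0 0.
  have l1 : lift ord0 ord0 = 1 :> 'I_3 by apply/val_inj.
  have l2 : lift ord0 (lift ord0 ord0) = 2 :> 'I_3 by apply/val_inj.
  rewrite !mxE !big_ord_recl big_ord0 !mxE /= addr0 l1 l2.
  by rewrite mulNr addrC [X in X - _]addrC.
rewrite (@mul_col_mx _ 1 2) (@mul_col_mx _ 1 1) !mul_row_col !mul0mx addr0 add0r mulNmx.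
rewrite addr0.
set u := \col_(j < 3) _; set w := \col_(j < 3) _.
have top (x y z : 'cV[R[i]]_1) :
    (col_mx x (col_mx y z) : 'cV_3) = u + E *: w <->
    [/\ x 0 0 = (u + E *: w) 0 0, y 0 0 = (u + E *: w) 1 0
      & z 0 0 = (u + E *: w) 2 0].
  have e0 : (col_mx x (col_mx y z) : 'cV_3) 0 0 = x 0 0.
    by rewrite -(col_mxEu x (col_mx y z)); congr (_ _ _); apply/val_inj.
  have e1 : (col_mx x (col_mx y z) : 'cV_3) 1 0 = y 0 0.
    rewrite -(col_mxEu y z) -(col_mxEd x (col_mx y z)).
    by congr (_ _ _); apply/val_inj.
  have e2 : (col_mx x (col_mx y z) : 'cV_3) 2 0 = z 0 0.
    rewrite -(col_mxEd y z) -(col_mxEd x (col_mx y z)).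
    by congr (_ _ _); apply/val_inj.
  split=> [<- //|[h0 h1 h2]]; apply/matrixP => i j; rewrite (ord1 j).
  case: i => [[|[|[|//]]] hi].
  - by rewrite (_ : Ordinal hi = 0) ?e0 //; apply/val_inj.
  - by rewrite (_ : Ordinal hi = 1) ?e1 //; apply/val_inj.
  - by rewrite (_ : Ordinal hi = 2) ?e2 //; apply/val_inj.
rewrite /global_relation1 /global_relation2.
have neg (z : 'cV[R[i]]_1) : (- z) 0 0 = - z 0 0 by rewrite mxE.
apply: conj => [/eq_col_mx[/top]|].
  rewrite neg !rowE !mxE /= => -[-> -> e] ->.
  apply: And4; [by rewrite addrC | by rewrite addrC | | by []].
  by rewrite addrC -e !opprD opprK.
case=> e1 e2 e3 ->; congr col_mx; apply/top.
rewrite neg !rowE !mxE /= -e1 -e2.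
apply: And3; [by rewrite addrC | by rewrite addrC | ].
by rewrite [RHS]addrC e3 !opprD opprK.
Qed.

Definition solvable_system (R : realType) (sigma1 sigma2 : R)
    (C : interface_conditions R) (r : nat) : Prop :=
  ~ (forall k : R[i], closure (@sector R r) k -> \det (system_mx sigma1 sigma2 C r k) = 0).

(* Rows and columns of beta are numbered from 0, so beta_31 is beta 2 0. *)
Definition solvability_criterion (R : realType) (sigma1 sigma2 : R) (beta : 'M[R[i]]_3) : Prop :=
  let s1 := sigma1%:C in let s2 := sigma2%:C in
  beta 2 0 != 0 \/
  s1 * beta 1 0 + s2 * beta 2 1 != 0 \/
  s1 ^+ 2 * beta 0 0 + s1 * s2 * beta 1 1 + s2 ^+ 2 * beta 2 2 != 0 \/
  s1 * beta 0 1 + s2 * beta 1 2 != 0 \/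
  beta 0 2 != 0.

(* Main.v *)
Require Import Defs.
From mathcomp Require Import all_boot all_order all_algebra.
From mathcomp Require Import all_classical all_reals all_analysis.
From mathcomp Require Import complex.
From mathcomp Require Import ring lra.

Import Order.TTheory GRing.Theory Num.Theory.
Local Open Scope ring_scope.

(** If the block [coef2] acting on h is singular, some combination of the
    conditions does not involve q^(2); since the problem does not reduce to
    half-lines, that combination is void, and the rows of the system matrix are
    dependent for every k.  If [coef2] is invertible, the conditions can be put
    in normal form, h can be eliminated, and a 3 x 3 determinant remains: it has
    rows s1 (a^2, a s1, s1^2) and s1 (b^2, b s1, s1^2) from q^(1), and
    s2 (c^2, c s2, s2^2) beta from q^(2), where a, c, b are i k times the
    consecutive powers r, r + 1, r + 2 of alpha.

    Because the cube roots of unity sum to zero, a + b = - c; moreover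
    a b = c^2.  Hence the cross product of the first two rows is
    s1^3 (a - b) (s1^2, s1 c, c^2), and the determinant is a nonzero multiple of
    k times a quartic polynomial in c ([crit_poly]), whose five coefficients
    are, up to nonzero factors, the five expressions of the criterion
    ([det_system_mx], [criterionP]).  If the quartic is zero, so is the
    determinant for every k; otherwise it cannot vanish along the ray that
    bisects the sector ([criterion_solvable]). *)

(** * Cube roots of unity *)

Section CubeRoots.
Variable R : realType.

Lemma expi_exp (t : R) (n : nat) : expi t ^+ n = expi (n%:R * t).
Proof.
elim: n => [|n IHn].
  by rewrite expr0 mul0r /expi cos0 sin0.
rewrite exprSr IHn /expi -[in RHS]natr1 mulrDl mul1r cosD sinD.
apply/eqP; rewrite eq_complex /=; apply/andP; split; apply/eqP => //.
by rewrite addrC.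
Qed.

Lemma expi_neq0 (t : R) : expi t != 0.
Proof.
apply/eqP => -[c0 s0]; have := cos2Dsin2 t.
by rewrite c0 s0 expr0n addr0 => /esym/eqP; rewrite oner_eq0.
Qed.

(** alpha is a root of X^3 - 1 other than 1, its imaginary part being positive. *)
Lemma alpha_sum0 : 1 + alpha R + alpha R ^+ 2 = 0.
Proof.
have a3 : alpha R ^+ 3 = 1.
  rewrite /alpha expi_exp.
  have -> : 3%:R * (2 * pi / 3) = pi *+ 2 :> R by field.
  by rewrite /expi cos2pi sin2pi.
have sa : 0 < sin (2 * pi / 3 : R).
  by apply: sin_gt0_pi; have := pi_gt0 R => ?; apply/andP; split; lra.
have a1 : alpha R - 1 != 0.
  by apply/eqP => -[_]; rewrite subr0 => s0; rewrite s0 ltxx in sa.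
apply: (mulfI a1); transitivity (alpha R ^+ 3 - 1); first by ring.
by rewrite a3 subrr mulr0.
Qed.

Lemma alpha_sqr_neq1 : alpha R ^+ 2 != 1.
Proof.
apply/eqP => a2; have := alpha_sum0; rewrite a2 => s0.
have a_2 : alpha R = - 2%:R by rewrite -[LHS]addr0 -oppr0 -s0; ring.
move: a2; rewrite a_2 => /eqP; rewrite -subr_eq0.
have -> : (- 2%:R) ^+ 2 - 1 = 3%:R :> R[i] by ring.
by rewrite pnatr_eq0.
Qed.

End CubeRoots.

(** * The determinant of the system *)

Lemma det_col_mx3 (K : comNzRingType) (u v w : 'rV[K]_3) :
  \det (col_mx u (col_mx v w) : 'M[K]_3)
  = (u 0 1 * v 0 2 - u 0 2 * v 0 1) * w 0 0
    + (u 0 2 * v 0 0 - u 0 0 * v 0 2) * w 0 1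
    + (u 0 0 * v 0 1 - u 0 1 * v 0 0) * w 0 2.
Proof.
set M := (X in \det X).
have e0 j : M 0 j = u 0 j.
  by rewrite -(col_mxEu u (col_mx v w)); congr (M _ _); apply/val_inj.
have e1 j : M 1 j = v 0 j.
  rewrite -(col_mxEu v w) -(col_mxEd u (col_mx v w)).
  by congr (M _ _); apply/val_inj.
have e2 j : M 2 j = w 0 j.
  rewrite -(col_mxEd v w) -(col_mxEd u (col_mx v w)).
  by congr (M _ _); apply/val_inj.
rewrite -!e0 -!e1 -!e2; move: (M) => {e0 e1 e2 u v w}M.
(* Behind [inord] only the value of an index matters, so that the nested lifts
   of the expansion collapse to numerals. *)
have -> : M = \matrix_(i < 3, j < 3) M (inord i) (inord j).
  by apply/matrixP => i j; rewrite mxE !inord_val.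
rewrite (expand_det_row _ ord0) !big_ord_recl big_ord0 /cofactor.
rewrite !(expand_det_row _ ord0) !big_ord_recl !big_ord0 /cofactor !det_mx11.
rewrite !mxE /= /bump /=.
by rewrite ?(addn0, add0n, addn1, add1n) /= !(expr0, expr1, exprS); ring.
Qed.

(** The product ('X^2, s2 'X, s2^2) beta (s1^2, s1 'X, 'X^2)^T, by powers of 'X. *)
Definition crit_poly {K : comNzRingType} (s1 s2 : K) (beta : 'M[K]_3) : {poly K} :=
  Poly [:: s1 ^+ 2 * s2 ^+ 2 * beta 2 0;
           s1 * s2 * (s1 * beta 1 0 + s2 * beta 2 1);
           s1 ^+ 2 * beta 0 0 + s1 * s2 * beta 1 1 + s2 ^+ 2 * beta 2 2;
           s1 * beta 0 1 + s2 * beta 1 2;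
           beta 0 2].

Section Criterion.
Local Open Scope complex_scope.

Lemma criterionP (R : realType) (sigma1 sigma2 : R) (beta : 'M[R[i]]_3) :
  sigma1 != 0 -> sigma2 != 0 ->
  solvability_criterion sigma1 sigma2 beta <->
  crit_poly sigma1%:C sigma2%:C beta != 0.
Proof.
move=> s1 s2.
have z1 : sigma1%:C != 0 :> R[i] by apply/eqP => -[] /eqP; apply/negP.
have z2 : sigma2%:C != 0 :> R[i] by apply/eqP => -[] /eqP; apply/negP.
rewrite /solvability_criterion /=; set a1 := sigma1%:C; set a2 := sigma2%:C.
have -> : (crit_poly a1 a2 beta != 0) =
    [|| beta 2 0 != 0, a1 * beta 1 0 + a2 * beta 2 1 != 0,
        a1 ^+ 2 * beta 0 0 + a1 * a2 * beta 1 1 + a2 ^+ 2 * beta 2 2 != 0,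
        a1 * beta 0 1 + a2 * beta 1 2 != 0 | beta 0 2 != 0].
  apply/idP/idP; last first.
    apply: contraTN => /eqP Q0.
    have coef j : (crit_poly a1 a2 beta)`_j = 0 by rewrite Q0 coef0.
    have := (coef 0%N, coef 1%N, coef 2%N, coef 3%N, coef 4%N).
    rewrite !coef_Poly /= => -[[[[/eqP c0 /eqP c1] -> ] ->] ->].
    move: c0 c1; rewrite !mulf_eq0 (negPf z1) (negPf z2) /=.
    by move=> -> ->; rewrite eqxx.
  apply: contraNT; rewrite !negb_or !negbK.
  case/and5P=> /eqP c0 /eqP c1 /eqP c2 /eqP c3 /eqP c4.
  apply/eqP/polyP => j; rewrite coef_Poly c0 c1 c2 c3 c4 !mulr0 coef0.
  by move: j => [|[|[|[|[|[|j]]]]]].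
split=> [|/or4P[|||/orP[]]]; last 5 first.
- by left.
- by right; left.
- by right; right; left.
- by right; right; right; left.
- by right; right; right; right.
by case=> [|[|[|[|]]]] ->; rewrite ?orbT.
Qed.

End Criterion.

(** Substituting h = - beta g, which is a unimodular column operation, clears
    the g-part of the interface conditions and so eliminates h. *)
Lemma det_eliminate (K : comNzRingType) (m n : nat) (L1 : 'M[K]_(m, m))
    (L2 : 'M[K]_(m, n)) (B2 : 'M[K]_n) (beta : 'M[K]_(n, m)) :
  \det (block_mx L1 L2 (B2 *m beta) B2) = \det (L1 - L2 *m beta) * \det B2.
Proof.
pose N : 'M[K]_(m + n) := block_mx 1%:M 0 (- beta) 1%:M.
have detN : \det N = 1 by rewrite det_lblock !det1 mulr1.
rewrite -[LHS]mulr1 -[X in _ * X = _]detN -det_mulmx mulmx_block.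
by rewrite !mulmx1 !mulmx0 !add0r !mulmxN subrr det_ublock.
Qed.

(** * Solvability *)

Section Solvability.
Import numFieldNormedType.Exports.
Variables (R : realType) (sigma1 sigma2 : R).
Local Open Scope complex_scope.

Lemma relations_mxE (r : nat) (k : R[i]) :
  relations_mx sigma1 sigma2 r k =
  row_mx (col_mx (relation_row sigma1 (alpha R ^+ r) k)
            (col_mx (relation_row sigma1 (alpha R ^+ r.+2) k) 0))
    (col_mx 0 (col_mx 0 (- relation_row sigma2 (alpha R ^+ r.+1) k))).
Proof.
rewrite /relations_mx /=.
rewrite -[X in col_mx _ X]block_mxEv block_mxEh.
by rewrite -[LHS]block_mxEv block_mxEh.
Qed.

(** In terms of kappa = i gamma k the coefficients are a geometric progression,
    which makes the cross product of two rows factor. *)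
Lemma relation_rowE (sigma : R) (gamma k : R[i]) (kappa := 'i * gamma * k) :
  relation_row sigma gamma k =
  \row_(n < 3) [:: sigma%:C * kappa ^+ 2; sigma%:C ^+ 2 * kappa; sigma%:C ^+ 3]`_n.
Proof.
apply/rowP => -[[|[|[|//]]] ?]; rewrite !mxE //=; rewrite /kappa.
  by rewrite !exprMn sqr_i; ring.
by ring.
Qed.

Lemma det_system_mx (C : interface_conditions R) (beta : 'M[R[i]]_3)
    (r : nat) (k : R[i]) (c := 'i * alpha R ^+ r.+1 * k) :
  given_in_form C beta ->
  \det (system_mx sigma1 sigma2 C r k) =
  sigma1%:C ^+ 3 * sigma2%:C * ('i * k * (alpha R ^+ r - alpha R ^+ r.+2))
  * (crit_poly sigma1%:C sigma2%:C beta).[c] * \det (coef2 C).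
Proof.
move=> [P [f [Pu]]] [PC1 PC2 _].
have coef1E : Defs.coef1 C = coef2 C *m beta.
  by rewrite -PC1 mulmxA (mulmx1C PC2) mul1mx.
rewrite /system_mx relations_mxE coef1E -[col_mx _ _]block_mxEv.
rewrite det_eliminate; congr (_ * _).
rewrite (@mul_col_mx _ 1 2) (@mul_col_mx _ 1 1) !mul0mx.
rewrite (@opp_col_mx _ 1 2) (@opp_col_mx _ 1 1) !oppr0.
rewrite (@add_col_mx _ 1 2) (@add_col_mx _ 1 1) !addr0 add0r mulNmx opprK.
rewrite det_col_mx3 !relation_rowE -/c.
set A := 'i * alpha R ^+ r * k; set B := 'i * alpha R ^+ r.+2 * k.
have ABsum : A + B = - c.
  apply/eqP; rewrite -subr_eq0 opprK /A /B /c !exprS.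
  apply/eqP; transitivity ('i * alpha R ^+ r * k * (1 + alpha R + alpha R ^+ 2)).
    by ring.
  by rewrite alpha_sum0 mulr0.
have ABmul : A * B = c ^+ 2 by rewrite /A /B /c !exprS; ring.
set s1 := sigma1%:C; set s2 := sigma2%:C.
set w := _ *m beta.
have wE j : w 0 j = s2 * c ^+ 2 * beta 0 j + s2 ^+ 2 * c * beta 1 j
                    + s2 ^+ 3 * beta 2 j.
  have l1 : lift ord0 ord0 = 1 :> 'I_3 by apply/val_inj.
  have l2 : lift ord0 (lift ord0 ord0) = 2 :> 'I_3 by apply/val_inj.
  by rewrite !mxE !big_ord_recl big_ord0 !mxE /= addr0 l1 l2 addrA.
move: w wE => w wE; rewrite !mxE /=.
(* The cross product of the two rows from q^(1), dotted with w. *)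
transitivity (s1 ^+ 3 * (A - B) *
  (s1 ^+ 2 * w 0 0 - s1 * (A + B) * w 0 1 + A * B * w 0 2)); first by ring.
have -> : 'i * k * (alpha R ^+ r - alpha R ^+ r.+2) = A - B by rewrite /A /B; ring.
rewrite ABsum ABmul /crit_poly horner_Poly /=.
by rewrite !wE; ring.
Qed.

(** If no combination of the conditions is a condition on q^(1) alone, a null
    combination of the rows of [coef2] is a null combination of the conditions,
    hence of the rows of the system matrix. *)
Lemma det_system_mx_eq0 (C : interface_conditions R) (r : nat) (k : R[i]) :
  ~ reduces_to_half_lines C -> \det (coef2 C) = 0 ->
  \det (system_mx sigma1 sigma2 C r k) = 0.
Proof.
move=> nred /eqP/det0P[v v0 vC2].
have vC1 : v *m Defs.coef1 C = 0.
  by apply: contra_notP nred => /eqP vC1; left; exists v.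
apply/eqP/det0P; exists (row_mx 0 v); first by rewrite row_mx_eq0 negb_and v0 orbT.
by rewrite mul_row_col mul0mx add0r mul_mx_row vC1 vC2 row_mx0.
Qed.

Lemma sector_bisector (rho : R) (r : nat) : 0 < rho -> (0 < r)%N ->
  @sector R r (rho%:C * expi ((r%:R - 2^-1) * pi / 3)).
Proof.
move=> rho0; case: r => // r _; exists rho, ((r.+1%:R - 2^-1) * pi / 3).
have pi3 : 0 < pi / 3 :> R by rewrite divr_gt0 ?pi_gt0.
by split=> //; rewrite -!mulrA ltr_pM2r //= -[r.+1%:R]natr1; lra.
Qed.

(** A quartic cannot vanish at five points of the bisector of the sector. *)
Lemma criterion_solvable (C : interface_conditions R) (beta : 'M[R[i]]_3) (r : nat) :
  0 < sigma1 -> 0 < sigma2 -> (0 < r)%N ->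
  given_in_form C beta -> solvability_criterion sigma1 sigma2 beta ->
  solvable_system sigma1 sigma2 C r.
Proof.
move=> s1 s2 r0 Cb; rewrite criterionP ?gt_eqF // => Q0 det0.
set Q := crit_poly _ _ _ in Q0.
have toC (x : R) : (x%:C == 0 :> R[i]) = (x == 0) by rewrite eq_complex eqxx andbT.
pose e := expi ((r%:R - 2^-1) * pi / 3 : R).
have e0 : e != 0 := expi_neq0 _ _.
have a0 : alpha R != 0 := expi_neq0 _ _.
pose z (n : nat) : R[i] := 'i * alpha R ^+ r.+1 * (n.+1%:R%:C * e).
have Qz n : root Q (z n).
  have /det0 : closure (@sector R r) (n.+1%:R%:C * e).
    by apply: subset_closure; apply: sector_bisector.
  rewrite (det_system_mx _ _ _ _ Cb) -/(z n) => /eqP.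
  rewrite !mulf_eq0 !toC (gt_eqF s1) (gt_eqF s2) pnatr_eq0 (negPf e0).
  have -> : alpha R ^+ r - alpha R ^+ r.+2 = alpha R ^+ r * (1 - alpha R ^+ 2).
    by rewrite !exprS; ring.
  rewrite mulf_eq0 expf_eq0 (negPf a0) andbF.
  rewrite subr_eq0 (eq_sym 1) (negPf (alpha_sqr_neq1 R)) (negPf (neq0Ci _)) /=.
  have [P [f [_ [_ PC2 _]]]] := Cb.
  have [_] := mulmx1_unit PC2; rewrite unitmxE unitfE => /negPf ->.
  by rewrite orbF.
have zI : injective z.
  move=> m n /(mulfI _) zmn.
  have /zmn/(mulIf e0)[] : 'i * alpha R ^+ r.+1 != 0 :> R[i].
    by rewrite mulf_neq0 ?neq0Ci ?expf_neq0.
  by move/eqP; rewrite eqr_nat eqSS => /eqP.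
have roots : all (root Q) (map z (iota 0 5)).
  by apply/allP => _ /mapP[n _ ->].
have uz : uniq (map z (iota 0 5)) by rewrite map_inj_uniq ?iota_uniq.
have := max_poly_roots Q0 roots uz; rewrite size_map size_iota ltnNge.
by rewrite (leq_trans (size_Poly _)).
Qed.

Lemma solvable_in_form (C : interface_conditions R) (r : nat) :
  0 < sigma1 -> 0 < sigma2 -> ~ reduces_to_half_lines C ->
  solvable_system sigma1 sigma2 C r ->
  exists beta : 'M[R[i]]_3,
    given_in_form C beta /\ solvability_criterion sigma1 sigma2 beta.
Proof.
move=> s1 s2 nred solv.
have C2u : coef2 C \in unitmx.
  rewrite unitmxE unitfE; apply/eqP => C20.
  by apply: solv => k _; apply: det_system_mx_eq0.
pose P := invmx (coef2 C).
have Cb : given_in_form C (P *m Defs.coef1 C).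
  exists P, (fun t => P *m datum C t); split; first by rewrite unitmx_inv.
  by rewrite /recombine mulVmx.
exists (P *m Defs.coef1 C); split=> //.
rewrite criterionP ?gt_eqF //; apply: contra_notN solv => /eqP Q0 k _.
by rewrite (det_system_mx _ _ _ _ Cb) Q0 horner0 mulr0 mul0r.
Qed.

End Solvability.

Theorem proposition2 (R : realType) (sigma1 sigma2 : R) (C : interface_conditions R)
    (r : nat) :
  0 < sigma1 -> 0 < sigma2 -> r \in [:: 1; 3; 5]%N ->
  ~ reduces_to_half_lines C ->
  (solvable_system sigma1 sigma2 C r <->
     exists beta : 'M[R[i]]_3,
       given_in_form C beta /\ solvability_criterion sigma1 sigma2 beta) /\
  (forall beta : 'M[R[i]]_3,
     given_in_form C beta -> solvability_criterion sigma1 sigma2 beta ->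
     solvable_system sigma1 sigma2 C r).
Proof.
move=> s1 s2 rodd nred.
have r0 : (0 < r)%N by case: r rodd.
have crit beta : given_in_form C beta ->
    solvability_criterion sigma1 sigma2 beta -> solvable_system sigma1 sigma2 C r.
  exact: criterion_solvable.
split=> //; split=> [|[beta [Cb critb]]]; last exact: crit critb.
exact: solvable_in_form.
Qed.
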